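(* Let $\lambda \in \mathbb{C}$. For every positive integer $n$ and every integer $m\ge 0$, $$\sum_{l=0}^{n-1}(l\mid\lambda)_m=\frac{1}{m+1}\left\{\beta_{m+1}(n\mid\lambda)-\beta_{m+1}(\lambda)\right\}.$$
   Context: For $\lambda,x\in\mathbb{C}$ and an integer $n\ge 0$, put $(x\mid\lambda)_n = x(x-\lambda)(x-2\lambda)\cdots(x-(n-1)\lambda)$, with $(x\mid\lambda)_0=1$. As a formal power series in $t$, $(1+\lambda t)^{x/\lambda}=\sum_{n\ge0}(x\mid\lambda)_n\frac{t^n}{n!}$ (for $\lambda=0$ this is read as the limit $e^{xt}$). The Carlitz degenerate Bernoulli polynomials $\beta_n(x\mid\lambda)$ are defined by $$\frac{t}{(1+\lambda t)^{1/\lambda}-1}(1+\lambda t)^{x/\lambda}=\sum_{n=0}^{\infty}\beta_n(x\mid\lambda)\frac{t^n}{n!},$$ and the degenerate Bernoulli numbers are $\beta_n(\lambda)=\beta_n(0\mid\lambda)$. *)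

(* Defs.v *)
From HB Require Import structures.
From mathcomp Require Import all_boot all_order all_algebra.
From mathcomp Require Import reals.
From mathcomp Require Export complex.

Set Implicit Arguments.
Unset Strict Implicit.
Unset Printing Implicit Defensive.

Import GRing.Theory.
Local Open Scope ring_scope.

(* A formal power series over F is its sequence of coefficients nat -> F. *)
Section PowerSeries.
Variable F : fieldType.
Implicit Types f g : nat -> F.

Definition ps1 : nat -> F := fun n => (n == 0%N)%:R.
Definition psX : nat -> F := fun n => (n == 1%N)%:R.
Definition pssub f g : nat -> F := fun n => f n - g n.
Definition psmul f g : nat -> F :=
  fun n => \sum_(i < n.+1) f i * g (n - i)%N.

(* The coefficients 0, ..., n of 1 / f, for f with f 0 != 0. *)
Fixpoint psinv_seq f (n : nat) : seq F :=
  if n is n'.+1 then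
    let s := psinv_seq f n' in
    rcons s (- (f 0%N)^-1 * \sum_(i < n) f i.+1 * s`_(n' - i))
  else [:: (f 0%N)^-1].
Definition psinv f : nat -> F := fun n => (psinv_seq f n)`_n.

(* f / t, for f with f 0 = 0. *)
Definition psshift f : nat -> F := fun n => f n.+1.

(* f / g as (f / t) * (g / t)^-1, for f 0 = g 0 = 0 and g 1 != 0; see psdivK. *)
Definition psdiv f g : nat -> F := psmul (psshift f) (psinv (psshift g)).

Lemma size_psinv_seq f n : size (psinv_seq f n) = n.+1.
Proof. by elim: n => //= n IHn; rewrite size_rcons IHn. Qed.

Lemma nth_psinv_seq f n i : (i <= n)%N -> (psinv_seq f n)`_i = psinv f i.
Proof.
elim: n => [|n IHn]; first by rewrite leqn0 => /eqP->.
rewrite leq_eqVlt => /orP[/eqP->//|lt_in].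
by rewrite /= nth_rcons size_psinv_seq lt_in IHn.
Qed.

Lemma psinvS f n : psinv f n.+1 =
  - (f 0%N)^-1 * \sum_(i < n.+1) f i.+1 * psinv f (n - i)%N.
Proof.
rewrite {1}/psinv /= nth_rcons size_psinv_seq ltnn eqxx; congr (_ * _).
by apply: eq_bigr => i _; rewrite nth_psinv_seq // leq_subr.
Qed.

Lemma psmulC f g : psmul f g =1 psmul g f.
Proof.
move=> n; rewrite /psmul (reindex_inj rev_ord_inj) /=.
by apply: eq_bigr => i _; rewrite subSS subKn -1?ltnS // mulrC.
Qed.

Lemma psmulfV f : f 0%N != 0 -> psmul f (psinv f) =1 ps1.
Proof.
move=> f0 [|n]; rewrite /psmul /ps1 big_ord_recl /= subn0.
  by rewrite big_ord0 addr0 mulfV.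
rewrite psinvS mulrA mulrN mulfV // mulN1r addrC; apply/eqP.
by rewrite subr_eq0; apply/eqP/eq_bigr => i _.
Qed.

Lemma psmulA f g h : psmul f (psmul g h) =1 psmul (psmul f g) h.
Proof.
move=> n; pose P u := \poly_(i < n.+1) (u i : F).
have PE u k : (k <= n)%N -> (P u)`_k = u k by rewrite coef_poly ltnS => ->.
have mE u v k : (k <= n)%N -> (P u * P v)`_k = psmul u v k.
  move=> le_kn; rewrite coefM; apply: eq_bigr => i _.
  rewrite !PE // ?(leq_trans (leq_subr _ _)) //.
  by rewrite (leq_trans _ le_kn) // -ltnS.
transitivity ((P f * (P g * P h))`_n).
  rewrite coefM; apply: eq_bigr => i _.
  by rewrite PE ?mE ?leq_subr // -ltnS.
rewrite mulrA coefM; apply: eq_bigr => i _.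
by rewrite mE ?PE ?leq_subr // -ltnS.
Qed.

Lemma psmul_shift f g n :
  f 0%N = 0 -> psmul f g n.+1 = psmul (psshift f) g n.
Proof.
move=> f0; rewrite /psmul big_ord_recl f0 mul0r add0r.
by apply: eq_bigr => i _.
Qed.

Lemma psdivK f g : f 0%N = 0 -> g 0%N = 0 -> g 1%N != 0 ->
  psmul g (psdiv f g) =1 f.
Proof.
move=> f0 g0 g1 [|n]; first by rewrite /psmul big_ord1 g0 mul0r f0.
rewrite psmul_shift // /psdiv psmulC -psmulA.
transitivity (psmul (psshift f) ps1 n).
  by apply: eq_bigr => i _; rewrite psmulC psmulfV.
rewrite /psmul big_ord_recr /= subnn mulr1 big1 ?add0r // => i _.
by rewrite /ps1 subn_eq0 leqNgt ltn_ord mulr0.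
Qed.

End PowerSeries.

Section Degenerate.
Variable F : fieldType.
Implicit Types lambda x : F.

Definition deg_ffact x lambda (n : nat) : F :=
  \prod_(i < n) (x - i%:R * lambda).

(* (1 + lambda t)^(x / lambda), read as e^(x t) when lambda = 0. *)
Definition deg_exp lambda x : nat -> F :=
  fun n => deg_ffact x lambda n / (n`!)%:R.

(* (t / ((1 + lambda t)^(1 / lambda) - 1)) (1 + lambda t)^(x / lambda) *)
Definition deg_bernoulli_gf x lambda : nat -> F :=
  psmul (psdiv (@psX F) (pssub (deg_exp lambda 1) (@ps1 F)))
        (deg_exp lambda x).

Definition deg_bernoulli_poly (n : nat) x lambda : F :=
  (n`!)%:R * deg_bernoulli_gf x lambda n.

Definition deg_bernoulli_num (n : nat) lambda : F :=
  deg_bernoulli_poly n 0 lambda.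

(* The series t / ((1 + lambda t)^(1 / lambda) - 1) is a genuine quotient. *)
Lemma deg_bernoulli_divK lambda :
  let g := pssub (deg_exp lambda 1) (@ps1 F) in
  psmul g (psdiv (@psX F) g) =1 @psX F.
Proof.
apply: psdivK => //; rewrite /pssub /ps1 /deg_exp /deg_ffact /=.
  by rewrite big_ord0 divr1 subrr.
by rewrite big_ord1 mul0r !subr0 divr1 oner_eq0.
Qed.

End Degenerate.

(* Main.v *)
(** Put [E x = (1 + lambda t)^(x / lambda)].  Since [E (x + y) = E x * E y], the
    generating function of the differences
    [beta_k (x + 1 | lambda) - beta_k (x | lambda)] is
    [t / (E 1 - 1) * (E 1 - 1) * E x = t * E x], so these differences equal
    [k (x | lambda)_(k-1)]; summing over [x = 0, ..., n - 1] telescopes. *)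

Require Import Defs.
From mathcomp Require Import all_boot all_order all_algebra.
From mathcomp Require Import reals.
From mathcomp Require Import ring.

Set Implicit Arguments.
Unset Strict Implicit.
Unset Printing Implicit Defensive.

Import GRing.Theory Num.Theory.
Local Open Scope ring_scope.

Section PowerSeriesExtra.
Variable F : fieldType.
Implicit Types f g h : nat -> F.

Lemma eq_psmull f g h : f =1 g -> psmul f h =1 psmul g h.
Proof. by move=> fg n; apply: eq_bigr => i _; rewrite fg. Qed.

Lemma eq_psmulr f g h : f =1 g -> psmul h f =1 psmul h g.
Proof. by move=> fg n; apply: eq_bigr => i _; rewrite fg. Qed.

Lemma psmul1 f : psmul (@ps1 F) f =1 f.
Proof.
move=> n; rewrite /psmul big_ord_recl subn0 mul1r big1 ?addr0 // => i _.
by rewrite /ps1 mul0r.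
Qed.

Lemma psmulBl f g h : psmul (pssub f g) h =1 pssub (psmul f h) (psmul g h).
Proof.
move=> n; rewrite /pssub /psmul -sumrB.
by apply: eq_bigr => i _; rewrite mulrBl.
Qed.

Lemma psmulBr f g h : psmul h (pssub f g) =1 pssub (psmul h f) (psmul h g).
Proof.
move=> n; rewrite /pssub /psmul -sumrB.
by apply: eq_bigr => i _; rewrite mulrBr.
Qed.

Lemma psmulXS f n : psmul (@psX F) f n.+1 = f n.
Proof. by rewrite psmul_shift // -[RHS]psmul1; apply: eq_psmull. Qed.

End PowerSeriesExtra.

Section DegenerateExp.
Variable F : numFieldType.
Implicit Types lambda x y : F.

Lemma deg_exp0 lambda x : deg_exp lambda x 0%N = 1.
Proof. by rewrite /deg_exp /deg_ffact big_ord0 divr1. Qed.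

(** Coefficient form of the differential equation $(1 + \lambda t) E' = x E$ satisfied by $E = (1 +
    \lambda t)^{x/\lambda}$. *)
Lemma deg_expS lambda x n :
  n.+1%:R * deg_exp lambda x n.+1 = (x - n%:R * lambda) * deg_exp lambda x n.
Proof.
rewrite /deg_exp /deg_ffact big_ord_recr /= factS natrM.
have n1_neq0 : n.+1%:R != 0 :> F by rewrite pnatr_eq0.
by rewrite invfM mulrCA mulVKf // mulrAC mulrC.
Qed.

(* Both sides [c] satisfy [(n + 1) c_(n+1) = (x + y - n lambda) c_n]: for the
   product, split [n + 1 = i + (n + 1 - i)] in each term. *)
Lemma deg_expD lambda x y :
  deg_exp lambda (x + y) =1 psmul (deg_exp lambda x) (deg_exp lambda y).
Proof.
elim=> [|n IHn]; first by rewrite /psmul big_ord1 !deg_exp0 mulr1.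
have n1_neq0 : n.+1%:R != 0 :> F by rewrite pnatr_eq0.
apply: (mulfI n1_neq0); rewrite deg_expS IHn.
transitivity
  (\sum_(i < n.+2) i%:R * deg_exp lambda x i * deg_exp lambda y (n.+1 - i)
   + \sum_(i < n.+2)
       deg_exp lambda x i * ((n.+1 - i)%:R * deg_exp lambda y (n.+1 - i))).
  (* The term [i = 0] of the first sum and the term [i = n.+1] of the second vanish. After shifting
     the first index, the factors $x - i\lambda$ and $y - (n - i)\lambda$ add up to $x + y -
     n\lambda$. *)
  rewrite big_ord_recl !mul0r add0r [X in _ = _ + X]big_ord_recr /=.
  rewrite subnn mul0r mulr0 addr0 -big_split mulr_sumr.
  apply: eq_bigr => i _ /=; have le_in : (i <= n)%N by rewrite -ltnS.
  rewrite /bump /= add1n subSS subSn // !deg_expS natrB //.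
  ring.
rewrite -big_split mulr_sumr; apply: eq_bigr => i _ /=.
rewrite natrB -1?ltnS //.
ring.
Qed.

Lemma deg_bernoulli_polyD1 lambda x m :
  deg_bernoulli_poly m.+1 (x + 1) lambda - deg_bernoulli_poly m.+1 x lambda =
  m.+1%:R * deg_ffact x lambda m.
Proof.
rewrite /deg_bernoulli_poly /deg_bernoulli_gf -mulrBr.
set g := pssub _ _; set D := psdiv _ g.
have gE : psmul g (deg_exp lambda x) =1
    pssub (deg_exp lambda (x + 1)) (deg_exp lambda x).
  by move=> k; rewrite psmulBl /pssub psmul1 addrC [x + 1]addrC deg_expD addrC.
rewrite -[X in _ * X]/(pssub (psmul D _) (psmul D _) m.+1) -psmulBr.
(* Reading [gE] backwards exposes the factor [g], which [D] turns into $t$; coefficient [m.+1] of $t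
   E_x$ is then coefficient [m] of $E_x$. *)
rewrite -(eq_psmulr D gE) psmulA (eq_psmull _ (psmulC D g)).
rewrite (eq_psmull _ (deg_bernoulli_divK lambda)) psmulXS /deg_exp.
have fact_neq0 : m`!%:R != 0 :> F by rewrite pnatr_eq0 -lt0n fact_gt0.
by rewrite factS natrM -mulrA [m`!%:R * _]mulrC divfK.
Qed.

End DegenerateExp.

Theorem theorem2p3 (R : realType) (lambda : R[i]) (n m : nat) (hn : (0 < n)%N) :
  \sum_(0 <= l < n) deg_ffact l%:R lambda m =
  (m.+1)%:R^-1 *
    (deg_bernoulli_poly m.+1 n%:R lambda - deg_bernoulli_num m.+1 lambda).
Proof.
have m1_neq0 : m.+1%:R != 0 :> R[i] by rewrite pnatr_eq0.
apply: (mulfI m1_neq0); rewrite mulVKf // mulr_sumr /deg_bernoulli_num.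
(* The degenerate Bernoulli number is the lower end of the telescope, since [0%:R] computes to
   [0]. *)
rewrite -(telescope_sumr (fun k => deg_bernoulli_poly m.+1 k%:R lambda) (leq0n n)).
by apply: eq_bigr => l _; rewrite -deg_bernoulli_polyD1 natr1.
Qed.
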